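(* Let $n\ge1$. Then $OT_n[0]$ is a maximal linear extension of $\overline{\mathbb{S}}_n^w[0]=\overline{\mathbb{S}}_n^s[0]$. That is, under the identification of $\overline{\mathbb{S}}_n[0]$ with $OT_n[0]$ via the map $f$, the ordering $s\preceq t:\Leftrightarrow f(s)\le f(t)$ is a well-order on $\overline{\mathbb{S}}_n[0]$ which extends $\le_{gap}^w$ (equivalently $\le_{gap}^s$), and its order type equals the maximal order type $o(\overline{\mathbb{S}}_n[0])$.
   Context: A well-partial-order (wpo) is a partial order $(X,\le_X)$ such that every infinite sequence $(x_i)_{i<\omega}$ in $X$ has indices $i<j$ with $x_i\le_Xx_j$. Its maximal order type $o(X)$ is the supremum of the order types of all well-orders on $X$ extending $\le_X$; a maximal linear extension is a well-order on $X$ extending $\le_X$ of order type $o(X)$. $\overline{\mathbb{S}}_n$ is the set of finite sequences $s_0\dots s_{k-1}$ over $\{0,\dots,n-1\}$ (including the empty sequence $\varepsilon$) such that $s_{i+1}\le s_i+1$ for all $i<k-1$. $\overline{\mathbb{S}}_n[0]$ is the subset of those sequences which are empty or have $s_0=0$. Weak gap-embeddability: $s_0\dots s_{k-1}\le_{gap}^w s'_0\dots s'_{l-1}$ iff there is a strictly increasing $g:\{0,\dots,k-1\}\to\{0,\dots,l-1\}$ with (1) $s_i=s'_{g(i)}$ for all $i$, and (2) for all $i<k-1$ and all $j$ with $g(i)<j<g(i+1)$, $s'_j\ge s'_{g(i+1)}=s_{i+1}$. Strong gap-embeddability $\le_{gap}^s$ additionally requires (3) $s'_j\ge s'_{g(0)}=s_0$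 for all $j<g(0)$. $\overline{\mathbb{S}}_n^w[0]$ and $\overline{\mathbb{S}}_n^s[0]$ denote $\overline{\mathbb{S}}_n[0]$ with $\le_{gap}^w$ and $\le_{gap}^s$ respectively; these two orderings coincide on $\overline{\mathbb{S}}_n[0]$. $OT_n$ is the least set of formal terms, with a function $S$, such that: $0\in OT_n$ with $S(0):=-1$; and if $\alpha,\beta\in OT_n$, $0\le i<n$, $S(\alpha)\le i+1$, $S(\beta)\le i$, and no symbol $\overline{\theta}_j$ with $j\le i$ occurs in $\alpha$ (in the paper: $K_i\alpha=\emptyset$), then $\overline{\theta}_i\alpha\beta\in OT_n$ with $S(\overline{\theta}_i\alpha\beta):=i$. The ordering $<$ on $OT_n$ is defined recursively by: $0<\overline{\theta}_i\alpha\beta$ always; and $\overline{\theta}_i\alpha\beta<\overline{\theta}_j\gamma\delta$ iff either $i<j$, or $i=j$ and one of the following holds: (a) $\alpha<\gamma$ and $\beta<\overline{\theta}_i\gamma\delta$; (b) $\alpha=\gamma$ and $\beta<\delta$; (c) $\alpha>\gamma$ and $\overline{\theta}_i\alpha\beta\le\delta$. $OT_n[0]:=\{\alpha\in OT_n:S(\alpha)\le0\}$. The map $f:\overline{\mathbb{S}}_n\to OT_n$ is defined by $f(\varepsilon):=0$ and $f(i\,u\,v):=\overline{\theta}_i(f(u))(f(v))$, where $u=i_1\dots i_k$ (possibly empty) is the maximal block of entries directly following the first entry $i$ with $i_1,\dots,i_k>i$, and $v$ is the remaining sequence, which is either empty or begins with some $j\le i$. *)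

(* Defs.v *)
From mathcomp Require Import all_boot all_order all_algebra.
From Stdlib Require Relations Classical ClassicalEpsilon.

Set Implicit Arguments.
Unset Strict Implicit.
Unset Printing Implicit Defensive.

(** [ord_lim h] denotes the least ordinal strictly above every [h a].  An ordinal
    has many representations, so ordinals are compared with [ord_le] and
    [ord_eq], never with [=]. *)
Inductive Ord : Type := ord_lim (A : Type) (h : A -> Ord).

Definition ord_dom (a : Ord) : Type := let: ord_lim A _ := a in A.
Definition ord_elt (a : Ord) : ord_dom a -> Ord :=
  match a with ord_lim _ h => h end.

Fixpoint ord_le (a b : Ord) {struct a} : Prop :=
  match a, b with
  | ord_lim A f, ord_lim B g => forall x : A, exists y : B, ord_le (f x) (g y)
  end.

Definition ord_eq (a b : Ord) : Prop := ord_le a b /\ ord_le b a.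

(** The union of the sets of ordinals below the [F i]. *)
Definition ord_sup (I : Type) (F : I -> Ord) : Ord :=
  @ord_lim {i : I & ord_dom (F i)} (fun p => ord_elt (projT2 p)).

Definition strict (T : Type) (R : T -> T -> Prop) (x y : T) : Prop :=
  R x y /\ x <> y.

Record well_order (T : Type) (R : T -> T -> Prop) : Prop := WellOrder {
  wo_order : Relation_Definitions.order T R;
  wo_total : forall x y, R x y \/ R y x;
  wo_wf : well_founded (strict R)
}.

(** The ordinal rank of [x]: the least ordinal above the ranks of the elements
    below [x]. *)
Fixpoint acc_rank (T : Type) (R : T -> T -> Prop) (x : T) (ax : Acc R x) : Ord :=
  @ord_lim {y : T | R y x} (fun y => acc_rank (Acc_inv ax (proj2_sig y))).

Definition order_type (T : Type) (R : T -> T -> Prop) (wR : well_order R) : Ord :=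
  ord_lim (fun x => acc_rank (wo_wf wR x)).

Record wpo (T : Type) (le : T -> T -> Prop) : Prop := Wpo {
  wpo_order : Relation_Definitions.order T le;
  wpo_good : forall x : nat -> T, exists i j, i < j /\ le (x i) (x j)
}.

Record wo_extension (T : Type) (le R : T -> T -> Prop) : Prop := WoExtension {
  ext_wo : well_order R;
  ext_sub : forall x y, le x y -> R x y
}.

Definition max_order_type (T : Type) (le : T -> T -> Prop) : Ord :=
  ord_sup (fun R : {R : T -> T -> Prop | wo_extension le R} =>
             order_type (ext_wo (proj2_sig R))).

Definition maximal_linear_extension (T : Type) (le R : T -> T -> Prop) : Prop :=
  wpo le /\
  exists eR : wo_extension le R,
    ord_eq (order_type (ext_wo eR)) (max_order_type le).

Lemma ord_le_refl a : ord_le a a.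
Proof. by elim: a => A f IH /= x; exists x; apply: IH. Qed.

Lemma ord_le_trans a b c : ord_le a b -> ord_le b c -> ord_le a c.
Proof.
elim: a b c => A f IH [B g] [C h] /= ab bc x.
by have [y xy] := ab x; have [z yz] := bc y; exists z; apply: IH xy yz.
Qed.

Lemma ord_le_sup (I : Type) (F : I -> Ord) i : ord_le (F i) (ord_sup F).
Proof.
rewrite /ord_sup; case E: (F i) => [A f] /= x.
have : exists y : ord_dom (F i), ord_elt y = f x by rewrite E; exists x.
move=> [y yx]; exists (existT _ i y); rewrite /= yx; exact: ord_le_refl.
Qed.

Lemma ord_sup_le (I : Type) (F : I -> Ord) b :
  (forall i, ord_le (F i) b) -> ord_le (ord_sup F) b.
Proof.
case: b => B g Fb /= [i y] /=; move: (Fb i) y.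
by case: (F i) => A f /= H y; apply: H.
Qed.

(** Comparing order types with [ord_le] is the usual comparison of well-orders. *)
Lemma order_type_leP (T U : Type) (R : T -> T -> Prop) (Q : U -> U -> Prop)
    (wR : well_order R) (wQ : well_order Q) :
  ord_le (order_type wR) (order_type wQ) <->
  exists h : T -> U, forall x y, strict R x y -> strict Q (h x) (h y).
Proof.
have rankE (V : Type) (P : V -> V -> Prop) x (a : Acc P x) :
    acc_rank a = @ord_lim {y : V | P y x}
      (fun y => acc_rank (Acc_inv a (proj2_sig y))) by case: a.
have rank_irr (V : Type) (P : V -> V -> Prop) x (a b : Acc P x) :
    ord_le (acc_rank a) (acc_rank b).
  elim/Acc_inv_dep: x / a b => x a IH b.
  by rewrite (rankE _ _ _ b) /= => y; exists y; apply: IH.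
split=> [le_RQ|[h hmono]]; last first.
  move=> x; exists (h x).
  elim/(well_founded_ind (wo_wf wR)): x => x IH.
  rewrite [acc_rank (wo_wf wR x)]rankE [acc_rank (wo_wf wQ _)]rankE.
  move=> [y yx]; exists (exist _ (h y) (hmono _ _ yx)) => /=.
  apply: ord_le_trans (rank_irr _ _ _ _ (wo_wf wR y)) _.
  exact: ord_le_trans (IH y yx) (rank_irr _ _ _ _ _).
pose below x z := ord_le (acc_rank (wo_wf wR x)) (acc_rank (wo_wf wQ z)).
have minE x : exists z, below x z /\ forall z', below x z' -> Q z z'.
  have [z xz] := le_RQ x; move: xz.
  elim/(well_founded_ind (wo_wf wQ)): z => z IH xz.
  case: (Classical_Prop.classic (exists z', strict Q z' z /\ below x z')).
    by move=> [z' [z'z xz']]; apply: IH z'z xz'.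
  move=> min_z; exists z; split=> // z' xz'.
  case: (wo_total wQ z z') => // z'z.
  case: (Classical_Prop.classic (z' = z)) => [->|ne].
    exact: (Relation_Definitions.ord_refl _ _ (wo_order wQ)).
  by case: min_z; exists z'; split.
pose h x := proj1_sig (ClassicalEpsilon.constructive_indefinite_description _ (minE x)).
have hP x : below x (h x) /\ forall z', below x z' -> Q (h x) z'.
  exact: proj2_sig (ClassicalEpsilon.constructive_indefinite_description _ (minE x)).
exists h => x y xy.
have := (hP y).1; rewrite /below [acc_rank (wo_wf wR y)]rankE.
rewrite [acc_rank (wo_wf wQ (h y))]rankE => /(_ (exist _ x xy)) [[z [zy ne]]] /= xz.
have Qz : Q (h x) z.
  apply: (hP x).2; have xz' : ord_le _ _ := xz.
  apply: ord_le_trans (rank_irr _ _ _ _ (Acc_inv (wo_wf wR y) xy)) _.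
  exact: ord_le_trans xz' (rank_irr _ _ _ _ _).
have [_ Qtr Qanti] := wo_order wQ.
split; first exact: Qtr Qz zy.
by move=> E; apply: (ne); apply: Qanti => //; rewrite -E.
Qed.

Definition Sbar (n : nat) (s : seq nat) : bool :=
  all (fun x => x < n) s && sorted (fun x y => y <= x.+1) s.

Definition Sbar0 (n : nat) (s : seq nat) : bool :=
  Sbar n s && (if s is x :: _ then x == 0 else true).

Definition weak_gap_map (s t : seq nat) (g : 'I_(size s) -> 'I_(size t)) : Prop :=
  [/\ forall i i' : 'I_(size s), i < i' -> g i < g i',
      forall i : 'I_(size s), nth 0 s i = nth 0 t (g i)
    & forall i i' : 'I_(size s), i' = i.+1 :> nat ->
      forall j : 'I_(size t), g i < j < g i' -> nth 0 t (g i') <= nth 0 t j].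

Definition initial_gap_cond (s t : seq nat) (g : 'I_(size s) -> 'I_(size t)) : Prop :=
  forall i : 'I_(size s), i = 0 :> nat ->
  forall j : 'I_(size t), j < g i -> nth 0 t (g i) <= nth 0 t j.

Definition gap_w (s t : seq nat) : Prop := exists g, @weak_gap_map s t g.

Definition gap_s (s t : seq nat) : Prop :=
  exists g, @weak_gap_map s t g /\ initial_gap_cond g.

Inductive term : Type :=
| Zero
| Theta (i : nat) (a b : term).

Definition OT_S (a : term) : int := if a is Theta i _ _ then i%:Z%R else (-1)%R.

Fixpoint indices (a : term) : seq nat :=
  if a is Theta i b c then i :: indices b ++ indices c else [::].

(** The last premise of [OT_Theta] is the condition that [K_i a] is empty: no symbol of
    index at most [i] occurs in [a]. *)
Inductive OT (n : nat) : term -> Prop :=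
| OT_Zero : OT n Zero
| OT_Theta i a b :
    OT n a -> OT n b -> i < n ->
    (OT_S a <= i%:Z + 1)%R -> (OT_S b <= i%:Z)%R ->
    (forall j, j <= i -> j \notin indices a) ->
    OT n (Theta i a b).

Definition OT0 (n : nat) (a : term) : Prop := OT n a /\ (OT_S a <= 0)%R.

(** The recursive clauses are all positive and decrease the total size of the
    two terms, so the least relation closed under them is the relation defined
    by recursion. *)
Inductive term_lt : term -> term -> Prop :=
| lt_Zero i a b : term_lt Zero (Theta i a b)
| lt_index i j a b c d : i < j -> term_lt (Theta i a b) (Theta j c d)
| lt_arg i a b c d :
    term_lt a c -> term_lt b (Theta i c d) -> term_lt (Theta i a b) (Theta i c d)
| lt_tail i a b d : term_lt b d -> term_lt (Theta i a b) (Theta i a d)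
| lt_sub_eq i a b c : term_lt c a -> term_lt (Theta i a b) (Theta i c (Theta i a b))
| lt_sub i a b c d :
    term_lt c a -> term_lt (Theta i a b) d -> term_lt (Theta i a b) (Theta i c d).

Definition term_le (a b : term) : Prop := term_lt a b \/ a = b.

(** Length of the maximal initial block of entries exceeding [i]. *)
Definition block_size (i : nat) (w : seq nat) : nat := find (fun j => j <= i) w.

(** The first argument is fuel; [seq_term_cons] is the intended equation. *)
Fixpoint seq_term_fuel (k : nat) (s : seq nat) : term :=
  match k, s with
  | k'.+1, i :: w =>
      Theta i (seq_term_fuel k' (take (block_size i w) w))
              (seq_term_fuel k' (drop (block_size i w) w))
  | _, _ => Zero
  end.

Definition seq_term (s : seq nat) : term := seq_term_fuel (size s) s.

Lemma seq_term_nil : seq_term [::] = Zero.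
Proof. by []. Qed.

Lemma seq_term_cons i w :
  seq_term (i :: w) =
    Theta i (seq_term (take (block_size i w) w))
            (seq_term (drop (block_size i w) w)).
Proof.
have fuelE k l s :
    size s <= k -> size s <= l -> seq_term_fuel k s = seq_term_fuel l s.
  elim: k l s => [|k IH] [|l] [|j v] //=; rewrite !ltnS => vk vl.
  have take_v m : size (take m v) <= size v by rewrite size_take_min geq_minr.
  have drop_v m : size (drop m v) <= size v by rewrite size_drop leq_subr.
  by congr Theta; apply: IH;
    apply: leq_trans (take_v _) _ || apply: leq_trans (drop_v _) _.
rewrite /seq_term /=; congr Theta; apply: fuelE => //.
  by rewrite size_take_min geq_minr.
by rewrite size_drop leq_subr.
Qed.

Definition Sbar0_type (n : nat) : Type := {s : seq nat | Sbar0 n s}.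

Definition Sbar0_gap_w (n : nat) (s t : Sbar0_type n) : Prop :=
  gap_w (proj1_sig s) (proj1_sig t).

Definition Sbar0_gap_s (n : nat) (s t : Sbar0_type n) : Prop :=
  gap_s (proj1_sig s) (proj1_sig t).

Definition Sbar0_prec (n : nat) (s t : Sbar0_type n) : Prop :=
  term_le (seq_term (proj1_sig s)) (seq_term (proj1_sig t)).

(* Main.v *)
From HB Require Import structures.
Require Import Defs.
From mathcomp Require Import all_boot all_order all_algebra.
From mathcomp Require Import zify.
From Stdlib Require Import Classical ClassicalEpsilon.

Set Implicit Arguments.
Unset Strict Implicit.
Unset Printing Implicit Defensive.

Import Order.TTheory.

(** A sequence that starts with 0 splits as 0 u_1 0 u_2 ... 0 u_k, where the
    entries of each u_i are positive and u_i, lowered by 1, is again such a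
    sequence over one symbol less.  Iterating, it becomes a word whose letters
    are words whose letters are words, and so on: a hereditary word, of height
    at most [n] ([to_seq_onto]).  Under this reading the map f is the identity
    ([seq_term_to_seq], [to_term_onto]), the gap order is the Higman embedding
    [emb] applied hereditarily, because a gap inside a block can never cross an
    entry 0 ([gap_emb_of_emb], [emb_of_gap_emb]), and the order on terms is a
    linear order [hlt] on hereditary words ([term_lt_to_term]).  That [hlt] is
    linear, well-founded and extends [emb] is elementary ([hlt_trichotomy],
    [hlt_trans], [hlt_wf], [emb_le]).

    What remains is that no linear extension is longer.  For [hlt], the words
    over letters q_0 < q_1 < ... enumerate the polynomials, with natural
    number coefficients, in one variable for each letter other than the least:
    up to absorption of smaller terms, putting a letter in front multiplies by its
    variable, and putting the least letter, the empty word, in front adds 1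
    ([poly_word]).  This is the ordinal omega^omega^o for o the type of the
    letters, up to the usual finite correction.  On the side of embeddings, a set
    has at most the type of a monomial m when, for each of its elements x, the
    elements not above x form a finite union of sets bounded by smaller monomials
    ([bounded]).  Products of sets multiply monomials ([bounded_prod]).  If a word
    v is not above x w, then either no letter of v is above x, or v = v0 y v1 with
    no letter of v0 above x and v1 not above w ([avoid_star]).  Hence, when a set
    P of letters is ranked by the polynomial that the word q codes, the set of
    words over P is bounded by the single variable q ([ranked_star]).  Each of the
    factors v0, y, v1 only contributes variables smaller than q: the first by
    induction on q, the last by induction on the length of x w, and the middle one
    because the polynomial coded by q only has variables that are smaller than q.  Since a letter of a word of letters is itself a
    hereditary word, the same order measures all levels.

    Therefore, among the words of height at most [n], those not above a given
    one are ranked by a word of height at most [n] ([level_rank]).  Keeping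
    only the elements not above a chosen element of a set lowers its rank
    ([ranked_avoid]); thus bad sequences are finite ([level_good]), and sending u
    to the least rank of the set of predecessors of u embeds any linear extension
    into [hlt] restricted to height [n] ([level_maximal]). *)

(** * Hereditary words and their order *)

(** Words whose letters are again such words; [Push] puts a letter in front. *)
Inductive hword : Type := Emp | Push (a w : hword).

Fixpoint hword_code (w : hword) : GenTree.tree unit :=
  if w is Push a v then GenTree.Node 0 [:: hword_code a; hword_code v]
  else GenTree.Leaf tt.

Fixpoint hword_decode (t : GenTree.tree unit) : option hword :=
  match t with
  | GenTree.Leaf _ => Some Emp
  | GenTree.Node _ [:: s; t] =>
      if (hword_decode s, hword_decode t) is (Some a, Some v)
      then Some (Push a v) else None
  | _ => None
  end.

Lemma hword_codeK : pcancel hword_code hword_decode.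
Proof. by elim=> //= a -> w ->. Qed.

HB.instance Definition _ := Countable.copy hword (pcan_type hword_codeK).

(** The order on terms when all indices are equal.  The clause for [b < a] is
    reached by elimination, relying on linearity, instead of by a call on [b] and
    [a]: this makes the recursion structural. *)
Fixpoint hlt (x : hword) : hword -> bool :=
  fix hlt_x (y : hword) : bool :=
    match x, y with
    | _, Emp => false
    | Emp, Push _ _ => true
    | Push a v, Push b w =>
        if hlt a b then hlt v y
        else if a == b then hlt v w
        else (x == w) || hlt_x w
    end.

Arguments hlt : simpl never.

Fixpoint hsize (w : hword) : nat :=
  if w is Push a v then (hsize a + hsize v).+1 else 0.

Lemma Push_eqE a v b w : (Push a v == Push b w) = (a == b) && (v == w).
Proof.
apply/eqP/andP=> [[-> ->]|[/eqP-> /eqP->]] //; by rewrite !eqxx.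
Qed.

Lemma hlt_Push a v b w :
  hlt (Push a v) (Push b w) =
    if hlt a b then hlt v (Push b w)
    else if a == b then hlt v w
    else (Push a v == w) || hlt (Push a v) w.
Proof. by []. Qed.

Lemma hltxx : irreflexive hlt.
Proof. by elim=> // a IHa v IHv; rewrite hlt_Push IHa eqxx. Qed.

(** Asymmetry and linearity are proved together: which clause defines
    [hlt y x] is only known once the heads are known to compare in one way. *)
Lemma hlt_trichotomy x y :
  (hlt x y -> ~~ hlt y x) /\ [|| x == y, hlt x y | hlt y x].
Proof.
have [k] := ubnP (hsize x + hsize y); elim: k x y => // k IH.
case=> [|a v] [|b w] // le_k.
have [| asym_ab tot_ab] := IH a b; first by move: le_k => /=; lia.
have [| asym_vy tot_vy] := IH v (Push b w); first by move: le_k => /=; lia.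
have [| asym_vw tot_vw] := IH v w; first by move: le_k => /=; lia.
have [| asym_xw tot_xw] := IH (Push a v) w; first by move: le_k => /=; lia.
rewrite !hlt_Push Push_eqE [b == a]eq_sym.
case: (eqVneq a b) => [E|neq_ab].
  by subst b; rewrite hltxx /=.
move: tot_ab; rewrite (negPf neq_ab) /=.
case: (boolP (hlt a b)) => [lt_ab _|nlt_ab /= lt_ba].
  rewrite (negPf (asym_ab lt_ab)) eq_sym; split.
    move=> lt_vy; rewrite negb_or (asym_vy lt_vy) andbT.
    by apply: contraTneq lt_vy => ->; rewrite hltxx.
  by case/or3P: tot_vy => ->; rewrite ?orbT.
rewrite lt_ba; split.
  case/orP=> [/eqP <-|/asym_xw//].
  by rewrite hltxx.
by case/or3P: tot_xw => ->; rewrite ?orbT.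
Qed.

Lemma hlt_asym x y : hlt x y -> hlt y x = false.
Proof. by case: (hlt_trichotomy x y) => asym _ /asym/negPf. Qed.

Lemma hlt_total x y : x != y -> hlt x y || hlt y x.
Proof. by move=> neq; case: (hlt_trichotomy x y) => _; rewrite (negPf neq). Qed.

Lemma hlt_pushP a v b w :
  reflect [\/ hlt a b /\ hlt v (Push b w), a = b /\ hlt v w |
              hlt b a /\ ((Push a v == w) || hlt (Push a v) w)]
          (hlt (Push a v) (Push b w)).
Proof.
rewrite hlt_Push; apply: (iffP idP).
  case: (boolP (hlt a b)) => [? ?|nlt]; first exact: Or31.
  case: eqVneq => [? ?|neq ?]; first exact: Or32.
  by apply: Or33; split=> //; move: (hlt_total neq); rewrite (negPf nlt).
case=> [[-> //]|[-> ?]|[lt_ba ?]]; first by rewrite hltxx eqxx.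
rewrite (hlt_asym lt_ba); case: eqVneq => // E.
by move: lt_ba; rewrite E hltxx.
Qed.

(** That a word lies below the words having it as a suffix is an instance of
    transitivity, which is only available afterwards; the second part is the
    other instance of transitivity that an induction on size needs. *)
Lemma hlt_suffix x y c :
  ((x == y) || hlt x y -> hlt x (Push c y)) /\
  (forall a v, x = Push a v -> (x == y) || hlt x y -> hlt v y).
Proof.
have [k] := ubnP (hsize x + hsize y); elim: k x y c => // k IH x y c le_k.
have tails a v : x = Push a v -> (x == y) || hlt x y -> hlt v y.
  move=> Ex /orP[/eqP Exy|].
    rewrite -Exy Ex; have [|+ _] := IH v v a; last by apply; rewrite eqxx.
    by move: le_k; rewrite -Exy Ex /=; lia.
  case: y {c} le_k => [|d w]; rewrite Ex => // le_k /hlt_pushP[[]//|[_ lt_vw]|[_ le_xw]].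
    have [|+ _] := IH v w d; last by apply; rewrite lt_vw orbT.
    by move: le_k => /=; lia.
  have lt_vw : hlt v w.
    have [|_ +] := IH (Push a v) w d; last by apply.
    by move: le_k => /=; lia.
  have [|+ _] := IH v w d; last by apply; rewrite lt_vw orbT.
  by move: le_k => /=; lia.
split=> // le_xy; case: x le_k tails le_xy => // a v le_k tails le_xy.
have lt_vy := tails _ _ erefl le_xy.
apply/hlt_pushP; case: (hlt_trichotomy a c) => _ /or3P[/eqP E|lt_ac|lt_ca].
- by apply: Or32.
- apply: Or31; split=> //; have [|+ _] := IH v y c; last by apply; rewrite lt_vy orbT.
  by move: le_k => /=; lia.
- by apply: Or33.
Qed.

Lemma hlt_Push_le x y c : (x == y) || hlt x y -> hlt x (Push c y).
Proof. exact: (hlt_suffix x y c).1. Qed.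

(** Cases on the clauses of both comparisons, with transitivity for smaller
    triples.  When [y < z] holds because [y] is at most the tail of [z], that
    tail is above [x], and [hlt_Push_le] concludes. *)
Lemma hlt_trans : transitive hlt.
Proof.
move=> y x z; have [k] := ubnP (hsize x + hsize y + hsize z).
elim: k x y z => // k IH [|a v] [|b w] [|c u] // le_k lt_xy lt_yz.
have lt_trans x' y' z' : hsize x' + hsize y' + hsize z' < k ->
  (x' == y') || hlt x' y' -> hlt y' z' -> hlt x' z'.
  by move=> lt_k /orP[/eqP->//|]; apply: IH.
move: (lt_xy) (lt_yz) => /hlt_pushP xy.
case/hlt_pushP=> [[lt_bc lt_wz]|[E lt_wu]|[lt_cb le_yu]].
- case: xy => [[lt_ab lt_vy]|[E lt_vw]|[lt_ba le_xw]].
  + apply/hlt_pushP/Or31; split.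
      by apply: (lt_trans _ b) => //; rewrite ?lt_ab ?orbT //; move: le_k => /=; lia.
    apply: (lt_trans _ (Push b w)) => //; rewrite ?lt_vy ?orbT //.
    by move: le_k => /=; lia.
  + apply/hlt_pushP/Or31; rewrite ?E; split=> //.
    apply: (lt_trans _ w) => //; rewrite ?lt_vw ?orbT //.
    by move: le_k => /=; lia.
  + by apply: (lt_trans _ w) => //; move: le_k => /=; lia.
- subst c; case: xy => [[lt_ab lt_vy]|[E lt_vw]|[lt_ba le_xw]].
  + apply/hlt_pushP/Or31; split=> //.
    apply: (lt_trans _ (Push b w)) => //; rewrite ?lt_vy ?orbT //.
    by move: le_k => /=; lia.
  + apply/hlt_pushP/Or32; split=> //.
    apply: (lt_trans _ w) => //; rewrite ?lt_vw ?orbT //.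
    by move: le_k => /=; lia.
  + apply: hlt_Push_le; apply/orP; right.
    by apply: (lt_trans _ w) => //; move: le_k => /=; lia.
- apply: hlt_Push_le; apply/orP; right.
  case/orP: le_yu => [/eqP <- //|lt_yu].
  apply: (lt_trans _ (Push b w)) => //; rewrite ?lt_xy ?orbT //.
  by move: le_k => /=; lia.
Qed.

Definition hle x y := (x == y) || hlt x y.

Fact hword_display : Order.disp_t. Proof. exact: (Order.Disp tt tt). Qed.

HB.instance Definition _ :=
  @Order.LtOrder.Build hword_display hword hle hlt
    (fun x y => if hlt x y then x else y) (fun x y => if hlt x y then y else x)
    (fun _ _ => erefl) (fun _ _ => erefl) (fun _ _ => erefl)
    hltxx hlt_trans hlt_total.

Section WordOrder.
Local Open Scope order_scope.
Implicit Types a b c v w x y : hword.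

Lemma lt_pushP a v b w :
  reflect [\/ a < b /\ v < Push b w, a = b /\ v < w | b < a /\ Push a v <= w]
          (Push a v < Push b w).
Proof. exact: hlt_pushP. Qed.

Lemma ltNEmp x : (x < Emp) = false.
Proof. by case: x. Qed.

Lemma lt_Push_arg a v b w : a < b -> v < Push b w -> Push a v < Push b w.
Proof. by move=> *; apply/lt_pushP/Or31. Qed.

Lemma lt_Push2l a v w : (Push a v < Push a w) = (v < w).
Proof.
apply/lt_pushP/idP => [[[]|[]|[]]|]; rewrite ?ltxx //.
by move=> lt_vw; apply: Or32.
Qed.

Lemma lt_Push c x : x < Push c x.
Proof. by apply: hlt_Push_le; rewrite eqxx. Qed.

Lemma le_lt_Push c x y : x <= y -> x < Push c y.
Proof. by move=> le_xy; apply: le_lt_trans le_xy (lt_Push c y). Qed.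

(** [Push a v] is accessible as soon as [a] and [v] are, by induction on the
    accessibility of [a], then of [v], then on the structure of the smaller word. *)
Lemma hlt_wf : well_founded (fun x y : hword => x < y).
Proof.
elim=> [|a Acc_a v Acc_v]; first by constructor=> y; rewrite ltNEmp.
elim: Acc_a v Acc_v => {}a _ IHa v Acc_v.
elim: Acc_v => {}v Acc_v IHv; constructor.
elim=> [_|b _ w IHw]; first by constructor=> y; rewrite ltNEmp.
case/lt_pushP=> [[lt_ba lt_w]|[-> lt_wv]|[_ le_wv]].
- exact: IHa lt_ba _ (IHw lt_w).
- exact: IHv.
- move: le_wv; rewrite le_eqVlt => /orP[/eqP->|lt_wv].
    by constructor.
  exact: Acc_v.
Qed.

(** * Heights *)

Fixpoint height (w : hword) : nat :=
  if w is Push a v then maxn (height a).+1 (height v) else 0%N.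

(** Words of bounded height form an initial segment: the ranks of subsets of
    [level n] stay in [level n] because of this. *)
Lemma lt_height x y : x < y -> (height x <= height y)%N.
Proof.
have [k] := ubnP (hsize x + hsize y); elim: k x y => // k IH.
case=> [|a v] [|b w] // le_k /lt_pushP[[lt_ab lt_vy]|[-> lt_vw]|[lt_ba]].
- rewrite [height (Push a v)]/= geq_max; apply/andP; split.
    rewrite /= leq_max ltnS IH ?orbT //; by move: le_k => /=; lia.
  by apply: IH => //; move: le_k => /=; lia.
- rewrite /= geq_max leq_max leqnn /= leq_max IH ?orbT //.
  by move: le_k => /=; lia.
- rewrite le_eqVlt => /orP[/eqP<-|lt_xw]; first by rewrite /= leq_maxr.
  rewrite /= [X in (_ <= X)%N]/= leq_max; apply/orP; right.
  by apply: (IH (Push a v)) => //; move: le_k => /=; lia.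
Qed.

Lemma height_lt x y : (height x < height y)%N -> x < y.
Proof.
move=> lt_h; rewrite ltNge le_eqVlt negb_or; apply/andP; split.
  by apply: contraTneq lt_h => ->; rewrite ltnn.
by apply: contraTN lt_h => /lt_height; rewrite -leqNgt.
Qed.

Lemma lt_letter a w : a < Push a w.
Proof. by apply: height_lt; rewrite /= leq_max leqnn. Qed.

(** * Words as polynomials *)

(** Adding a multiple of the variable [c] to [x] absorbs the leading letters of
    [x] below [c], as in ordinal addition, and shares the factor [c] if [x] then
    starts with it; [strip c x] is the other factor, to which the quotient of the
    summand by [c] is to be added. *)
Fixpoint strip c x : hword :=
  match x with
  | Emp => Emp
  | Push a y => if a < c then strip c y else if a == c then y else x
  end.

Lemma strip_le c x : strip c x <= x.
Proof.
elim: x => //= a _ y IH; case: ifP => _; first exact/ltW/le_lt_Push.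
by case: ifP => // _; exact/ltW/lt_Push.
Qed.

Lemma lt_Push_strip c x y : strip c x < y -> x < Push c y.
Proof.
elim: x => //= a _ x IH.
case: (ltgtP a c) => [lt_ac /IH|lt_ca lt_xy|->]; first exact: lt_Push_arg.
  exact/le_lt_Push/ltW.
by rewrite lt_Push2l.
Qed.

(** The condition on the first letter of [y] excludes that [y] is the word
    [strip c x] itself, when that word starts with a letter above [c]. *)
Lemma strip_lt_Push c x y :
  (if y is Push d _ then d <= c else false) -> x < Push c y -> strip c x < y.
Proof.
move=> yc; elim: x => [|a _ x IH] lt_x /=; first by case: y yc {lt_x}.
case: (ltgtP a c) lt_x => [lt_ac lt_x|lt_ca|->].
- by apply: IH; apply: lt_trans lt_x; apply: lt_Push.
- case/lt_pushP=> [[lt_ac]|[E]|[_]].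
  + by move: (lt_trans lt_ac lt_ca); rewrite ltxx.
  + by move: lt_ca; rewrite E ltxx.
  rewrite le_eqVlt => /orP[/eqP E|//].
  by move: yc; rewrite -E leNgt lt_ca.
- by rewrite lt_Push2l.
Qed.

(** A monomial is a list of variables, indexed by the words other than [Emp].
    [add_monomial m x] is the word of the sum [x + m], for [m] in non-increasing
    order and not above any monomial of [x].  Once all factors of [m] are pulled
    out, the constant 1 remains to be added, which is to put [Emp] in front. *)
Fixpoint add_monomial (m : seq hword) (x : hword) : hword :=
  if m is c :: n then Push c (add_monomial n (strip c x)) else Push Emp x.

Lemma lt_add_monomial m x : x < add_monomial m x.
Proof.
elim: m x => [|c m IH] x /=; first exact: lt_Push.
exact/lt_Push_strip/IH.
Qed.

Lemma letter_lt_add_monomial m x c : c \in m -> c < add_monomial m x.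
Proof.
elim: m x => //= d m IH x; rewrite inE => /orP[/eqP->|/IH lt_c].
  exact: lt_letter.
exact/le_lt_Push/ltW.
Qed.

Lemma add_monomial_lt_Push c m x y :
  Emp < c -> all (< c) m -> x < Push c y -> add_monomial m x < Push c y.
Proof.
move=> c0; elim: m x => [|d m IH] x /= => [_|/andP[lt_dc lt_mc]] lt_x.
  exact: lt_Push_arg.
apply: lt_Push_arg => //; apply: IH => //.
by apply: le_lt_trans lt_x; apply: strip_le.
Qed.

Lemma sorted_add_monomial c n w :
  sorted >=%O (c :: n) ->
  if add_monomial n w is Push d _ then d <= c else false.
Proof.
by case: n => [_|d n /= /andP[]//]; case: c.
Qed.

(** Additive indecomposability: below [w + n], adding any number of monomials
    smaller than [n] stays below [w + n].  Common leading variables cancel by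
    [strip_lt_Push]; at the first difference, the variable of [n] is above all
    remaining variables of [m], and [add_monomial_lt_Push] applies. *)
Lemma add_monomial_lt (m n : seqlexi hword) x w :
  sorted >=%O m -> sorted >=%O n -> all (> Emp) n ->
  m < n -> x < add_monomial n w -> add_monomial m x < add_monomial n w.
Proof.
elim: n m x w => [|c n IH] [|d m] x w // sm sn /= => /andP[c0 n0].
  by move=> _; apply: lt_Push_arg.
rewrite ltxi_cons => /andP[le_dc /implyP lt_mn] lt_x.
move: (le_dc); rewrite le_eqVlt => /orP[/eqP E|lt_dc]; last first.
  apply: (add_monomial_lt_Push (m := d :: m)) => //=; rewrite lt_dc /=.
  move: sm => /=; rewrite (path_sortedE ge_trans) => /andP[le_md _].
  by apply: sub_all le_md => e le_ed; apply: le_lt_trans lt_dc.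
rewrite E lt_Push2l; apply: IH (lt_mn _) _ => //; rewrite ?E //.
- exact: path_sorted sm.
- exact: path_sorted sn.
- by apply: strip_lt_Push lt_x; apply: sorted_add_monomial.
Qed.

End WordOrder.

Section PolyWord.
Local Open Scope order_scope.

(** Replacing an element of a multiset by smaller ones decreases its
    non-increasing list lexicographically; [r] lists the elements that are
    kept and not below the replaced one. *)
Lemma sort_replace d (T : orderType d) (z s : seq T) c :
  all (< c) s ->
  exists r s1 s2, [/\ sort >=%O (z ++ s) = r ++ s1,
    sort >=%O (c :: z) = r ++ c :: s2 & all (< c) s1].
Proof.
move=> lt_sc.
have sortedE (t u : seq T) : perm_eq t u -> pairwise >=%O u -> sort >=%O t = u.
  move=> tu su; apply: (sorted_eq ge_trans ge_anti).
  - by apply: sort_sorted; apply: ge_total.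
  - by rewrite (sorted_pairwise ge_trans).
  - by rewrite perm_sort.
have sorted_pair (t : seq T) : pairwise >=%O (sort >=%O t).
  by rewrite -(sorted_pairwise ge_trans) sort_sorted //; apply: ge_total.
have part (t : seq T) : perm_eq ([seq x <- t | c <= x] ++ [seq x <- t | x < c]) t.
  rewrite (@eq_filter _ (< c) (predC (>= c))) ?perm_filterC //.
  by move=> x /=; rewrite ltNge.
exists (sort >=%O [seq x <- z | c <= x]),
  (sort >=%O ([seq x <- z | x < c] ++ s)), (sort >=%O [seq x <- z | x < c]).
have lt1 : all (< c) ([seq x <- z | x < c] ++ s) by rewrite all_cat filter_all.
have lt2 : all (< c) [seq x <- z | x < c] by rewrite filter_all.
have ge_r : all (>= c) (sort >=%O [seq x <- z | c <= x]) by rewrite all_sort filter_all.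
have cat_ok (t : seq T) : all (<= c) t ->
    pairwise >=%O (sort >=%O [seq x <- z | c <= x] ++ t) = pairwise >=%O t.
  move=> le_t; rewrite pairwise_cat sorted_pair /= andb_idl // => _.
  by apply/allrelP => x y /(allP ge_r) ge_x /(allP le_t) /le_trans; apply.
split; last by rewrite all_sort.
- apply: sortedE; last first.
    by rewrite cat_ok ?sorted_pair // all_sort; apply: sub_all lt1 => x /ltW.
  apply: (@perm_trans _ (([seq x <- z | c <= x] ++ [seq x <- z | x < c]) ++ s)).
    by rewrite perm_cat // perm_sym.
  by rewrite -catA perm_cat // perm_sym perm_sort.
- apply: sortedE; last first.
    rewrite cat_ok /=; last by rewrite lexx all_sort; apply: sub_all lt2 => x /ltW.
    by rewrite sorted_pair andbT all_sort; apply: sub_all lt2 => x /ltW.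
  rewrite perm_sym -[c :: sort _ _]cat1s perm_catCA /= perm_cons.
  by apply: perm_trans (part z); rewrite perm_cat // perm_sort.
Qed.

(** [n] arises from [m] by replacing one variable by finitely many smaller ones:
    one step of the multiset order.  In this form compatibility with products
    is immediate, and lists need to be sorted only in [below_sort]. *)
Definition below (n m : seq hword) : Prop :=
  exists z c s, [/\ perm_eq n (z ++ s), perm_eq m (c :: z) &
    all (fun e => Emp < e < c) s].

Lemma below_sort n m :
  below n m -> (sort >=%O n : seqlexi hword) < (sort >=%O m : seqlexi hword).
Proof.
case=> z [c [s [nE mE lt_s]]].
have lt_sc : all (< c) s by apply: sub_all lt_s => e /andP[].
have [r [s1 [s2 [E1 E2 lt1]]]] := sort_replace z lt_sc.
have -> : sort >=%O n = r ++ s1.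
  by rewrite -E1; apply/(perm_sortP ge_total ge_trans ge_anti).
have -> : sort >=%O m = r ++ c :: s2.
  by rewrite -E2; apply/(perm_sortP ge_total ge_trans ge_anti).
elim: r {E1 E2} => [|e r IH] /=; last by rewrite ltxi_cons lexx.
by case: s1 lt1 => [|e s1] //= /andP[lt_ec _]; rewrite ltxi_cons (ltW lt_ec) leNgt lt_ec.
Qed.

Lemma below_cat_l k n m : below n m -> below (n ++ k) (m ++ k).
Proof.
case=> z [c [s [nE mE lt_s]]]; exists (z ++ k), c, s; split=> //.
  by rewrite (permPl (perm_cat nE (perm_refl k))) -!catA perm_cat2l perm_catC.
by rewrite (permPl (perm_cat mE (perm_refl k))).
Qed.

Lemma below_cat_r k n m : below n m -> below (k ++ n) (k ++ m).
Proof.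
move=> /(below_cat_l k) [z [c [s [nE mE lt_s]]]]; exists z, c, s.
by split=> //; rewrite perm_catC.
Qed.

Lemma below_single q m : all (fun e => Emp < e < q) m -> below m [:: q].
Proof. by move=> lt_m; exists [::], q, m. Qed.

Definition add_monomials : hword -> seq (seq hword) -> hword :=
  foldl (fun x m => add_monomial m x).

(** The word coding a sum of monomials.  The summands are added from the largest to
    the smallest, as otherwise [add_monomial] would absorb some of them. *)
Definition poly_word (ms : seq (seq hword)) : hword :=
  add_monomials Emp
    (sort >=%O [seq sort >=%O m : seqlexi hword | m : seq hword <- ms]).

Lemma le_add_monomials x ms : x <= add_monomials x ms.
Proof.
elim: ms x => //= m ms IH x; apply: le_trans (IH _).
exact/ltW/lt_add_monomial.
Qed.

Lemma letter_lt_add_monomials x (ms : seq (seq hword)) m c :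
  m \in ms -> c \in m -> c < add_monomials x ms.
Proof.
elim: ms x => //= n ms IH x; rewrite inE => /orP[/eqP-> c_n|]; last exact: IH.
apply: lt_le_trans (le_add_monomials _ _); exact: letter_lt_add_monomial.
Qed.

Lemma letter_lt_poly_word (ms : seq (seq hword)) m c :
  m \in ms -> c \in m -> c < poly_word ms.
Proof.
move=> m_ms c_m; apply: (letter_lt_add_monomials _ (m := sort >=%O m)).
  by rewrite mem_sort; apply: (map_f (fun m => sort >=%O m : seqlexi hword)).
by rewrite mem_sort.
Qed.

Lemma add_monomials_lt (ms : seq (seqlexi hword)) (m : seqlexi hword) x w :
  all (< m) ms -> all (sorted >=%O) ms -> sorted >=%O m -> all (> Emp) m ->
  x < add_monomial m w -> add_monomials x ms < add_monomial m w.
Proof.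
move=> + + sm m0; elim: ms x => //= n ms IH x /andP[lt_n lt_ms] /andP[sn sms] lt_x.
by apply: IH => //; apply: add_monomial_lt.
Qed.

(** Replacing a summand by smaller ones decreases the word: after the
    summands not below [m], shared by both sides, only monomials smaller than [m]
    are added on the left. *)
Lemma poly_word_replace z s m :
  all (fun e => Emp < e) m -> (forall n, n \in s -> below n m) ->
  poly_word (z ++ s) < poly_word (m :: z).
Proof.
move=> m0 lt_s; rewrite /poly_word map_cat /=.
set desc := fun m : seq hword => (sort >=%O m : seqlexi hword).
have lt_s' : all (< desc m) (map desc s).
  by rewrite all_map; apply/allP => n /lt_s/below_sort.
have [r [s1 [s2 [Es Em lt1]]]] := sort_replace (map desc z) lt_s'.
rewrite Es Em /add_monomials !foldl_cat /=.
apply: lt_le_trans (le_add_monomials _ s2).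
have sort_desc n : sorted >=%O (desc n) by apply: sort_sorted; apply: ge_total.
have sorted1 : all (sorted >=%O) s1.
  apply/allP => n n_s1; have : n \in r ++ s1 by rewrite mem_cat n_s1 orbT.
  by rewrite -Es mem_sort mem_cat => /orP[] /mapP[k _ ->]; apply: sort_desc.
have m0' : all (> Emp) (desc m) by rewrite all_sort.
exact: add_monomials_lt (lt_add_monomial _ _).
Qed.

Lemma poly_word_perm ms ns : perm_eq ms ns -> poly_word ms = poly_word ns.
Proof.
move=> E; rewrite /poly_word; congr add_monomials.
apply/(@perm_sortP (seqlexi hword) >=%O ge_total ge_trans ge_anti).
exact: perm_map.
Qed.

(** The bound [0 < k] is there for the letter [Emp], which occurs in the word of
    every nonzero polynomial. *)
Lemma height_poly_word k ms :
  (0 < k)%N -> all (all (fun e => height e < k)%N) ms -> (height (poly_word ms) <= k)%N.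
Proof.
move=> k0 lt_k; rewrite /poly_word.
have: all (all (fun e => height e < k)%N)
    (sort >=%O [seq sort >=%O m : seqlexi hword | m : seq hword <- ms]).
  rewrite all_sort all_map; apply: sub_all lt_k => m /=.
  by rewrite all_sort.
elim: (sort _ _) Emp (leq0n k : height Emp <= k)%N => //= m ns IH x le_x /andP[lt_m].
apply: IH; elim: m x le_x lt_m => [|c m IH] x le_x /= => [_|/andP[lt_c lt_m]].
  by rewrite geq_max k0.
rewrite geq_max lt_c IH //; apply: leq_trans le_x.
have := strip_le c x; rewrite le_eqVlt => /orP[/eqP-> //|].
exact: lt_height.
Qed.

End PolyWord.

(** * Sets bounded by monomials *)

Section Bounds.
Local Open Scope order_scope.

(** Finite unions of sets, each labelled with a monomial. *)
Definition pieces (T : Type) : Type := seq ((T -> Prop) * seq hword).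

Definition covers (T : Type) (ps : pieces T) (A : T -> Prop) : Prop :=
  forall y, A y -> exists p, List.In p ps /\ p.1 y.

(** This says that the maximal order type of [A] is at most the ordinal of the
    monomial [m].  Asking for a decomposition into finitely many smaller pieces, and
    not merely for a smaller ordinal, makes products easy to bound. *)
Inductive bounded (T : Type) (le : T -> T -> Prop) :
    (T -> Prop) -> seq hword -> Prop :=
| Bounded A m :
    (forall x, A x -> exists ps : pieces T,
       covers ps (fun y => A y /\ ~ le x y) /\
       forall p, List.In p ps -> below p.2 m /\ bounded le p.1 p.2) ->
    bounded le A m.

(** The generated principle has no induction hypothesis for the recursive
    occurrences below the existential quantifier. *)
Lemma bounded_nested_ind (T : Type) (le : T -> T -> Prop)
    (Q : (T -> Prop) -> seq hword -> Prop) :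
  (forall A m,
     (forall x, A x -> exists ps : pieces T,
        covers ps (fun y => A y /\ ~ le x y) /\
        forall p, List.In p ps ->
          [/\ below p.2 m, bounded le p.1 p.2 & Q p.1 p.2]) ->
     Q A m) ->
  forall A m, bounded le A m -> Q A m.
Proof.
move=> step; fix IH 3 => A m [{}A {}m H]; apply: step => x /H [ps [cov Hps]].
by exists ps; split=> // p /Hps [lt_p bp]; split=> //; apply: IH.
Qed.

Lemma bounded_avoid (T : Type) (le : T -> T -> Prop) A m x :
  bounded le A m -> A x -> exists ps : pieces T,
    covers ps (fun y => A y /\ ~ le x y) /\
    forall p, List.In p ps -> below p.2 m /\ bounded le p.1 p.2.
Proof. by case=> {}A {}m H /H. Qed.

Lemma In_cat (T : Type) (x : T) s t :
  List.In x (s ++ t) <-> List.In x s \/ List.In x t.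
Proof. exact: List.in_app_iff. Qed.

Lemma In_map (T U : Type) (f : T -> U) s y :
  List.In y (map f s) <-> exists x, f x = y /\ List.In x s.
Proof. exact: List.in_map_iff. Qed.

Lemma In_allpairs (T U V : Type) (f : T -> U -> V) s t z :
  List.In z (allpairs f s t) <->
  exists x y, [/\ f x y = z, List.In x s & List.In y t].
Proof.
elim: s => [|x s IH] /=; first by split=> // -[x [y []]].
rewrite In_cat In_map IH; split.
  case=> [[y [<- y_t]]|[x' [y [<- x_s y_t]]]]; first by exists x, y; split=> //; left.
  by exists x', y; split=> //; right.
case=> x' [y [<- [<-|x_s] y_t]]; first by left; exists y.
by right; exists x', y.
Qed.

(** Images under monotone maps, and subsets as the case of the identity. *)
Lemma bounded_image (T U : Type) (le : T -> T -> Prop) (le' : U -> U -> Prop)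
    (f : T -> U) (A : T -> Prop) (B : U -> Prop) m :
  (forall x y, le x y -> le' (f x) (f y)) ->
  (forall y, B y -> exists x, A x /\ f x = y) ->
  bounded le A m -> bounded le' B m.
Proof.
move=> f_mono BfA bA; elim/bounded_nested_ind: bA B BfA => {}A {}m IH B BfA.
constructor=> y /BfA [x [/IH [ps [cov Hps]] <-]].
pose im (p : (T -> Prop) * seq hword) := ((fun y => exists x, p.1 x /\ f x = y), p.2).
exists (map im ps); split.
  move=> _ [/BfA [x' [Ax' <-]] nle].
  have [|p [p_ps px']] := cov x'; first by split=> // /f_mono.
  by exists (im p); split; [apply/In_map; exists p|exists x'].
move=> _ /In_map [p [<- /Hps [lt_p bp IHp]]]; split=> //.
by apply: IHp => z [x' [px' <-]]; exists x'.
Qed.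

Definition prod_le (T U : Type) (le : T -> T -> Prop) (le' : U -> U -> Prop)
  (x y : T * U) : Prop := le x.1 y.1 /\ le' x.2 y.2.

Definition prod_set (T U : Type) (A : T -> Prop) (B : U -> Prop)
  (x : T * U) : Prop := A x.1 /\ B x.2.

(** A pair not above (x, y) has its first component not above x or its second
    one not above y, so that one of the two factors is replaced by its smaller
    pieces. *)
Lemma bounded_prod (T U : Type) (le : T -> T -> Prop) (le' : U -> U -> Prop) A B m n :
  bounded le A m -> bounded le' B n ->
  bounded (prod_le le le') (prod_set A B) (m ++ n).
Proof.
move=> bA; elim/bounded_nested_ind: bA B n => {}A {}m IHA B n bB.
elim/bounded_nested_ind: (bB) => {bB}B {}n IHB.
have bB : bounded le' B n.
  constructor=> x /IHB [ps [cov Hps]]; exists ps; split=> // p /Hps.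
  by case.
constructor=> -[x y] [/= /IHA [ps [cov Hps]] /IHB [qs [cov' Hqs]]].
exists ([seq (prod_set p.1 B, p.2 ++ n) | p <- ps] ++
        [seq (prod_set A q.1, m ++ q.2) | q <- qs]); split.
  move=> [u v] [[/= Au Bv] nle].
  case: (classic (le x u)) => [le_xu|nle_xu].
    have [|q [q_qs qv]] := cov' v; first by split=> // le_yv; apply: nle.
    exists (prod_set A q.1, m ++ q.2); split=> //.
    by apply/In_cat; right; apply/In_map; exists q.
  have [|p [p_ps pu]] := cov u; first by [].
  exists (prod_set p.1 B, p.2 ++ n); split=> //.
  by apply/In_cat; left; apply/In_map; exists p.
move=> r /In_cat [] /In_map [p [<-]] /=.
  by case/Hps=> lt_p _ IHp; split; [apply: below_cat_l|apply: IHp].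
by case/Hqs=> lt_p _ IHp; split; [apply: below_cat_r|].
Qed.

End Bounds.

(** * Embeddings of words over a bounded alphabet *)

Section Star.
Local Open Scope order_scope.

(** Higman's embedding of words, with letters compared by the same relation. *)
Inductive emb : hword -> hword -> Prop :=
| emb_Emp w : emb Emp w
| emb_skip v b w : emb v w -> emb v (Push b w)
| emb_Push a v b w : emb a b -> emb v w -> emb (Push a v) (Push b w).

Fixpoint star (P : hword -> Prop) (w : hword) : Prop :=
  if w is Push a v then P a /\ star P v else True.

Fixpoint hcat (v w : hword) : hword :=
  if v is Push a v' then Push a (hcat v' w) else w.

Definition avoid (P : hword -> Prop) x y : Prop := P y /\ ~ emb x y.

Lemma emb_hcat v v' w w' : emb v v' -> emb w w' -> emb (hcat v w) (hcat v' w').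
Proof.
move=> emb_v emb_w; elim: emb_v => {v v'} [v|v b v' _ IH|a v b v' emb_ab _ _ IH] /=.
- elim: v => //= b _ v IH; exact: emb_skip.
- exact: emb_skip.
- exact: emb_Push.
Qed.

(** Higman's decomposition, at the first letter of [v] that is above [x]. *)
Lemma avoid_star P x w v :
  avoid (star P) (Push x w) v ->
  star (avoid P x) v \/
  exists v0 y v1, [/\ v = hcat v0 (Push y v1), star (avoid P x) v0, P y &
    avoid (star P) w v1].
Proof.
elim: v => [|y _ v IH] [] /=; first by left.
move=> [Py Pv] nemb; case: (classic (emb x y)) => [emb_xy|nemb_xy].
  right; exists Emp, y, v; split=> //; split=> // emb_wv.
  by apply: nemb; apply: emb_Push.
have [||[v0 [z [v1 [-> av0 Pz av1]]]]] := IH.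
- by split=> // emb_v; apply: nemb; apply: emb_skip.
- by move=> av; left.
- by right; exists (Push y v0), z, v1; split.
Qed.

(** Piecewise boundedness only records which variables occur: this is all that
    matters for the words over [A]. *)
Definition pw_bounded (C : hword -> bool) (A : hword -> Prop) : Prop :=
  exists ps : pieces hword, covers ps A /\
    forall p, List.In p ps -> bounded emb p.1 p.2 /\ all C p.2.

(** By [avoid_star], applied once for each letter of [w], the words over [P] not
    above [w] are covered by products of sets of letters of [P] and of sets
    [star (avoid P x)]. *)
Lemma pw_bounded_star (C : hword -> bool) (P : hword -> Prop) :
  (forall x, P x -> exists m, bounded emb (star (avoid P x)) m /\ all C m) ->
  pw_bounded C P ->
  forall w, star P w -> pw_bounded C (avoid (star P) w).
Proof.
move=> starP [ps [cov Hps]]; elim=> [_|x _ w IH /= [Px Pw]].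
  exists [::]; split=> // y [_ []]; exact: emb_Emp.
have [qs [cov' Hqs]] := IH Pw; have [m [bm Cm]] := starP _ Px.
pose glue (v : hword * (hword * hword)) := hcat v.1 (Push v.2.1 v.2.2).
pose im (p q : (hword -> Prop) * seq hword) :=
  ((fun v => exists u, prod_set (star (avoid P x)) (prod_set p.1 q.1) u /\ glue u = v),
   m ++ (p.2 ++ q.2)).
exists ((star (avoid P x), m) :: allpairs im ps qs); split.
  move=> v /avoid_star [sv|[v0 [y [v1 [-> sv0 Py av1]]]]].
    by exists (star (avoid P x), m); split=> //; left.
  have [p [p_ps py]] := cov _ Py; have [q [q_qs qv1]] := cov' _ av1.
  exists (im p q); split; first by right; apply/In_allpairs; exists p, q.
  by exists (v0, (y, v1)).
move=> _ [<- //|/In_allpairs [p [q [<- /Hps [bp Cp] /Hqs [bq Cq]]]]].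
split; last by rewrite /= !all_cat Cm Cp Cq.
apply: (bounded_image (f := glue) (A := prod_set (star (avoid P x)) (prod_set p.1 q.1)))
  (bounded_prod bm (bounded_prod bp bq)) => //.
move=> [u0 [u1 u2]] [v0 [v1 v2]] [/= le0 [/= le1 le2]].
by apply: emb_hcat => //; apply: emb_Push.
Qed.

(** [P] has maximal order type at most the ordinal of the word [q], read as the
    polynomial that is the sum of the bounds of finitely many pieces of [P]. *)
Definition ranked (P : hword -> Prop) (q : hword) : Prop :=
  exists ps : pieces hword, [/\ covers ps P,
    forall p, List.In p ps -> bounded emb p.1 p.2 /\ all (> Emp) p.2
    & q = poly_word [seq p.2 | p <- ps]].

Lemma ranked_sub (P Q : hword -> Prop) q :
  (forall x, Q x -> P x) -> ranked P q -> ranked Q q.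
Proof.
by move=> QP [ps [cov Hps ->]]; exists ps; split=> // y /QP/cov.
Qed.

(** A piece that contains [x] is replaced by its smaller pieces, and the others
    are kept. *)
Lemma ranked_avoid P q x :
  ranked P q -> P x -> exists2 r, r < q & ranked (avoid P x) r.
Proof.
move=> [ps [cov Hps ->]] Px.
have [[A m] [p_ps /= Ax]] := cov _ Px.
have [ps1 [ps2 E]] := List.in_split _ _ p_ps.
have psE p' : List.In p' ps <-> p' = (A, m) \/ List.In p' (ps1 ++ ps2).
  rewrite E List.in_app_iff In_cat /=; split=> [[|[|]]|[|[|]]] => [?|->|?|->|?|?]; tauto.
have [/= bA m0] := Hps _ p_ps; have [qs [covq Hqs]] := bounded_avoid bA Ax.
exists (poly_word [seq p.2 | p <- (ps1 ++ ps2) ++ qs]); last first.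
  exists ((ps1 ++ ps2) ++ qs); split=> //.
    move=> y [Py nle]; have [p' [/psE [->|p'_ps] py]] := cov _ Py.
      have [r [r_qs ry]] := covq y (conj py nle).
      by exists r; split=> //; apply/In_cat; right.
    by exists p'; split=> //; apply/In_cat; left.
  move=> r /In_cat [r_ps|/Hqs [lt_r br]].
    by apply: Hps; apply/psE; right.
  split=> //; case: lt_r => z [c [s [rE mE lt_s]]].
  rewrite (perm_all _ rE) all_cat; apply/andP; split.
    by move: m0; rewrite (perm_all _ mE) => /andP[].
  by apply: sub_all lt_s => e /andP[].
have -> : poly_word [seq p.2 | p <- ps] = poly_word (m :: [seq p.2 | p <- ps1 ++ ps2]).
  apply: poly_word_perm.
  have -> : ps = cat ps1 ((A, m) :: ps2) by [].
  by rewrite !map_cat /= -cat1s perm_catCA.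
rewrite map_cat; apply: poly_word_replace => // n.
elim: qs {covq} Hqs => //= r qs IH Hqs; rewrite inE => /orP[/eqP->|].
  by case: (Hqs r (or_introl erefl)).
by apply: IH => r' r'_qs; apply: Hqs; right.
Qed.

(** The bound for words over an alphabet of rank [q].  An alphabet of rank [Emp]
    is empty, and the only word over it is bounded by the empty monomial 1. *)
Definition variable (q : hword) : seq hword := if q is Push _ _ then [:: q] else [::].

(** Induction on [q].  Letters not above a letter [x] of [P] have a smaller rank [r],
    so that [star (avoid P x)] is bounded by the variable [r]; and [P] itself is
    a union of sets bounded by monomials of [q], whose variables are below [q] as
    letters of [q] lie below [q]. *)
Lemma ranked_star P q : ranked P q -> bounded emb (star P) (variable q).
Proof.
elim/(well_founded_ind hlt_wf): q P => q IH P rP.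
case: (rP) => ps [cov Hps qE].
have trac : forall w, star P w -> pw_bounded (fun e => Emp < e < q) (avoid (star P) w).
  apply: pw_bounded_star.
    move=> x Px; have [r lt_rq rr] := ranked_avoid rP Px.
    exists (variable r); split; first exact: IH.
    by case: (r) lt_rq => //= a v ->.
  exists ps; split=> // p p_ps; have [bp p0] := Hps _ p_ps; split=> //.
  apply/allP => e e_p; rewrite (allP p0 _ e_p) /= qE.
  apply: letter_lt_poly_word e_p.
  elim: (ps) p_ps => //= p' ps' IHps [->|/IHps]; rewrite inE ?eqxx // => ->.
  by rewrite orbT.
constructor=> -[|a w] Pw.
  by exists [::]; split=> // y [_ []]; apply: emb_Emp.
have q0 : variable q = [:: q].
  case: Pw => /= Pa _; have [r] := ranked_avoid rP Pa.
  by case: (q) => //; rewrite ltNEmp.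
have [qs [cov' Hqs]] := trac _ Pw; exists qs; split=> // r /Hqs [br Cr].
by split=> //; rewrite q0; apply: below_single.
Qed.

End Star.

(** * The maximal order type of the words of bounded height *)

Section Levels.
Local Open Scope order_scope.

Lemma emb_refl w : emb w w.
Proof. by elim: w => [|a IHa v IHv]; [apply: emb_Emp|apply: emb_Push]. Qed.

Lemma emb_trans u v w : emb u v -> emb v w -> emb u w.
Proof.
move=> uv vw; elim: vw u uv => {v w} [w|v b w _ IH|a v b w _ IHa _ IHv] u uv.
- by case: u uv => [|a u] uv; [apply: emb_Emp|inversion uv].
- exact/emb_skip/IH.
- inversion uv; subst.
  + exact: emb_Emp.
  + by apply: emb_skip; apply: IHv.
  + by apply: emb_Push; [apply: IHa|apply: IHv].
Qed.

Lemma emb_le u v : emb u v -> u <= v.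
Proof.
elim=> {u v} [w|v b w _ IH|a v b w _ le_ab _ le_vw].
- by case: w.
- exact/ltW/le_lt_Push.
- move: le_ab; rewrite le_eqVlt => /orP[/eqP->|lt_ab].
    move: le_vw; rewrite le_eqVlt => /orP[/eqP->//|lt_vw].
    by rewrite ltW // lt_Push2l.
  by apply/ltW/lt_Push_arg => //; apply: le_lt_Push.
Qed.

Definition level (n : nat) (w : hword) : Prop := (height w <= n)%N.

Lemma star_level n w : star (level n) w <-> level n.+1 w.
Proof.
rewrite /level; elim: w => //= a _ w ->; rewrite geq_max ltnS.
by split=> [[-> ->]|/andP].
Qed.

(** The least word of height [n]. *)
Fixpoint tower (n : nat) : hword := if n is k.+1 then Push (tower k) Emp else Emp.

Lemma height_tower n : height (tower n) = n.
Proof. by elim: n => //= n ->; rewrite maxn0. Qed.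

Lemma bounded_of_pw_bounded (C : hword -> bool) (P : hword -> Prop) q :
  (forall e, C e -> Emp < e < q) ->
  (forall w, P w -> pw_bounded C (avoid P w)) -> bounded emb P [:: q].
Proof.
move=> Cq trac; constructor=> w /trac [ps [cov Hps]]; exists ps; split=> // p.
by case/Hps=> bp Cp; split=> //; apply: below_single; apply: sub_all Cp.
Qed.

Lemma ranked_of_pw_bounded k (P : hword -> Prop) :
  pw_bounded (fun e => (Emp < e) && (height e <= k)%N) P ->
  exists2 q, level k.+1 q & ranked P q.
Proof.
move=> [ps [cov Hps]]; exists (poly_word [seq p.2 | p <- ps]); last first.
  exists ps; split=> // p /Hps [bp Cp]; split=> //.
  by apply: sub_all Cp => e /andP[].
apply: height_poly_word => //; rewrite all_map.
elim: ps Hps {cov} => //= p ps IH Hps; apply/andP; split.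
  have [_ Cp] := Hps p (or_introl erefl).
  by apply: sub_all Cp => e /andP[].
by apply: IH => p' p'_ps; apply: Hps; right.
Qed.

Lemma level_pw_bounded n :
  bounded emb (level n) (variable (tower n)) ->
  (forall x, level n x -> exists2 q, level n q & ranked (avoid (level n) x) q) ->
  forall w, level n.+1 w ->
    pw_bounded (fun e => (Emp < e) && (height e <= n)%N) (avoid (level n.+1) w).
Proof.
move=> b_n r_n w /star_level w_n.
have [||ps [cov Hps]] := @pw_bounded_star (fun e => (Emp < e) && (height e <= n)%N)
    (level n) _ _ w w_n.
- move=> x /r_n [q q_n rq]; exists (variable q); split; first exact: ranked_star.
  by case: q q_n {rq} => //= a v ->.
- exists [:: (level n, variable (tower n))]; split.
    by move=> y yn; exists (level n, variable (tower n)); split=> //; left.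
  move=> _ [<-|//]; split=> //=.
  have := height_tower n; by case: (tower n) => //= a v ->; rewrite leqnn.
- by exists ps; split=> // y [/star_level yn nle]; apply: cov.
Qed.

(** The words of height at most [n.+1] are the words over the alphabet [level n].
    No word of height at most [n] ranks this alphabet, so that the argument for
    [ranked_star] is repeated with [tower n.+1] in the place of the rank: the
    sets [avoid (level n) x] have ranks of height at most [n], and [level n] is
    bounded by the variable [tower n]; thus all variables that occur have height
    at most [n] and are below [tower n.+1]. *)
Theorem level_rank n :
  bounded emb (level n) (variable (tower n)) /\
  (forall w, level n w -> exists2 q, level n q & ranked (avoid (level n) w) q).
Proof.
elim: n => [|n [b_n r_n]].
  have no w : level 0 w -> forall y, ~ avoid (level 0) w y.
    rewrite /level; case: w => [_ y []|a v]; last by rewrite /= geq_max.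
    by move=> _; apply; apply: emb_Emp.
  split.
    by constructor=> w /no w0; exists [::]; split=> // y /w0.
  move=> w /no w0; exists Emp => //; exists [::]; split=> // y /w0 //.
have trac := level_pw_bounded b_n r_n; split.
  apply: bounded_of_pw_bounded trac => e /andP[-> le_e].
  by apply: height_lt; rewrite height_tower ltnS.
by move=> w /trac /ranked_of_pw_bounded.
Qed.

(** A bad sequence would produce an infinite descent of ranks. *)
Lemma ranked_good P q :
  ranked P q -> forall x : nat -> hword, (forall i, P (x i)) ->
  exists i j, (i < j)%N /\ emb (x i) (x j).
Proof.
elim/(well_founded_ind hlt_wf): q P => q IH P rP x Px.
have [r lt_rq rr] := ranked_avoid rP (Px 0%N).
case: (classic (exists j, emb (x 0%N) (x j.+1))) => [[j e0j]|nemb].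
  by exists 0%N, j.+1.
have [|i [j [lt_ij e_ij]]] := IH _ lt_rq _ rr (fun i => x i.+1).
  by move=> i; split=> // e0; apply: nemb; exists i.
by exists i.+1, j.+1.
Qed.

Lemma level_good n (x : nat -> hword) :
  (forall i, level n (x i)) -> exists i j, (i < j)%N /\ emb (x i) (x j).
Proof.
move=> xn; have [_ /(_ _ (xn 0%N)) [q _ rq]] := level_rank n.
case: (classic (exists j, emb (x 0%N) (x j.+1))) => [[j e0j]|nemb].
  by exists 0%N, j.+1.
have [|i [j [lt_ij e_ij]]] := ranked_good rq (x := fun i => x i.+1).
  by move=> i; split=> // e0; apply: nemb; exists i.
by exists i.+1, j.+1.
Qed.

(** The set of predecessors of [u] in a linear extension avoids [u], so that it
    has a rank of height at most [n], and the least one is taken as [h u].  If [v]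
    precedes [u], then the predecessors of [v] are predecessors of [u] avoiding
    [v], and their rank drops by [ranked_avoid]. *)
Theorem level_maximal n (U : Type) (R : U -> U -> Prop) (f : U -> hword) :
  well_order R -> (forall u, level n (f u)) ->
  (forall u v, emb (f u) (f v) -> R u v) ->
  exists h : U -> hword, (forall u, level n (h u)) /\
    (forall u v, strict R u v -> h u < h v).
Proof.
move=> wR fn embR; have [_ r_n] := level_rank n.
pose below_f u w := exists2 v, strict R v u & f v = w.
have below_avoid u v : strict R v u -> forall w, below_f v w -> avoid (below_f u) (f v) w.
  have [_ Rtr Ranti] := wo_order wR.
  move=> [Rvu vu] w [v' [Rv'v v'v] <-]; split.
    exists v' => //; split; first exact: Rtr Rv'v Rvu.
    by move=> E; apply: v'v; apply: Ranti => //; rewrite E.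
  by move/embR=> Rvv'; apply: v'v; apply: Ranti.
have minE u : exists q, [/\ level n q, ranked (below_f u) q &
    forall r, level n r -> ranked (below_f u) r -> q <= r].
  have [q qn rq] := r_n _ (fn u).
  have {}rq : ranked (below_f u) q.
    apply: ranked_sub rq => _ [v [Rvu vu] <-]; split=> // /embR Ruv.
    by have [_ _ Ranti] := wo_order wR; apply: vu; apply: Ranti.
  elim/(well_founded_ind hlt_wf): q qn rq => q IH qn rq.
  case: (classic (exists r, [/\ level n r, ranked (below_f u) r & r < q])).
    by case=> r [rn rr lt_rq]; apply: IH lt_rq rn rr.
  move=> nr; exists q; split=> // r rn rr; rewrite leNgt; apply/negP => lt_rq.
  by apply: nr; exists r.
pose h u := proj1_sig (constructive_indefinite_description _ (minE u)).
have hP u : [/\ level n (h u), ranked (below_f u) (h u) &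
    forall r, level n r -> ranked (below_f u) r -> h u <= r].
  exact: proj2_sig (constructive_indefinite_description _ (minE u)).
exists h; split=> [u|v u Rvu]; first by case: (hP u).
have [hn rh _] := hP u; have [_ _ hmin] := hP v.
have [r lt_r rr] := ranked_avoid rh (ex_intro2 _ _ v Rvu erefl : below_f u (f v)).
apply: (le_lt_trans _ lt_r); apply: hmin.
  exact: leq_trans (lt_height lt_r) hn.
exact: ranked_sub (below_avoid _ _ Rvu) rr.
Qed.

End Levels.

(** * Sequences and terms as hereditary words *)

(** The letters of a word at depth [k] are sequences of entries above [k], each
    introduced by an entry [k]. *)
Fixpoint to_seq (k : nat) (w : hword) : seq nat :=
  if w is Push a v then k :: to_seq k.+1 a ++ to_seq k v else [::].

Fixpoint to_term (k : nat) (w : hword) : term :=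
  if w is Push a v then Theta k (to_term k.+1 a) (to_term k v) else Zero.

Lemma to_seq_ge k w : all (leq k) (to_seq k w).
Proof.
elim: w k => //= a IHa w IHw k; rewrite leqnn all_cat IHw andbT.
by apply: sub_all (IHa k.+1) => x /ltnW.
Qed.

Lemma seq_term_to_seq k w : seq_term (to_seq k w) = to_term k w.
Proof.
elim: w k => //= a IHa w IHw k; rewrite seq_term_cons.
have -> : block_size k (to_seq k.+1 a ++ to_seq k w) = size (to_seq k.+1 a).
  rewrite /block_size find_cat; case: ifP => [/hasP[x xa le_xk]|_].
    by have := allP (to_seq_ge k.+1 a) _ xa; rewrite ltnNge le_xk.
  by case: w {IHw} => [|b w] /=; rewrite ?leqnn ?addn0.
by rewrite take_size_cat // drop_size_cat // IHa IHw.
Qed.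

Lemma to_term_inj k : injective (to_term k).
Proof.
move=> v w; elim: v k w => [|a IHa v IHv] k [|b w] //= [/IHa -> /IHv ->] //.
Qed.

Lemma term_lt_to_term k v w :
  term_lt (to_term k v) (to_term k w) <-> (v < w)%O.
Proof.
have [s] := ubnP (hsize v + hsize w); elim: s k v w => // s IH k.
case=> [|a v] [|b w] //= le_s; try by split=> // H; inversion H.
- by split=> // _; apply: lt_Zero.
have ab : term_lt (to_term k.+1 a) (to_term k.+1 b) <-> (a < b)%O.
  by apply: IH; move: le_s => /=; lia.
have ba : term_lt (to_term k.+1 b) (to_term k.+1 a) <-> (b < a)%O.
  by apply: IH; move: le_s => /=; lia.
have vy : term_lt (to_term k v) (to_term k (Push b w)) <-> (v < Push b w)%O.
  by apply: IH; move: le_s => /=; lia.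
have vw : term_lt (to_term k v) (to_term k w) <-> (v < w)%O.
  by apply: IH; move: le_s => /=; lia.
have xw : term_lt (to_term k (Push a v)) (to_term k w) <-> (Push a v < w)%O.
  by apply: IH; move: le_s => /=; lia.
split.
- move=> H; apply/lt_pushP; inversion H; subst.
  + by lia.
  + by apply: Or31; split; [apply/ab|apply/vy].
  + by apply: Or32; split; [apply: (@to_term_inj k.+1)|apply/vw].
  + apply: Or33; split; first exact/ba.
    by rewrite (_ : w = Push a v) // ; apply: (@to_term_inj k).
  + by apply: Or33; split; [apply/ba|apply/ltW/xw].
- case/lt_pushP=> [[/ab lt_ab /vy lt_vy]|[-> /vw lt_vw]|[/ba lt_ba]].
  + exact: lt_arg.
  + exact: lt_tail.
  + rewrite le_eqVlt => /orP[/eqP <-|/xw lt_xw]; first exact: lt_sub_eq.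
    exact: lt_sub.
Qed.

Definition step (x y : nat) : bool := y <= x.+1.

Lemma path_to_seq x k w : k <= x.+1 -> path step x (to_seq k w).
Proof.
elim: w x k => //= a IHa w IHw x k le_kx; rewrite /step le_kx cat_path IHa //= IHw //.
apply: leqW; case: (to_seq k.+1 a) (to_seq_ge k.+1 a) => // y s ge_ys.
exact/ltnW/(allP ge_ys)/mem_last.
Qed.

Lemma to_seq_lt n k w : height w + k <= n -> all (ltn^~ n) (to_seq k w).
Proof.
elim: w k => //= a IHa w IHw k; rewrite addn_maxl geq_max => /andP[le_a le_w].
rewrite all_cat IHa ?IHw ?andbT; lia.
Qed.

Lemma Sbar0_to_seq n w : level n w -> Sbar0 n (to_seq 0 w).
Proof.
move=> le_w; rewrite /Sbar0 /Sbar to_seq_lt ?addn0 //=.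
have := @path_to_seq 0 0 w isT; case: w {le_w} => //= a w ->.
by rewrite eqxx.
Qed.

(** A block following an entry [k] starts with [k.+1], as entries grow by at
    most 1 and those of the block exceed [k]. *)
Lemma to_seq_onto n k s :
  all (fun x => k <= x < n) s -> sorted step s -> head k s = k ->
  exists2 w, height w <= n - k & s = to_seq k w.
Proof.
have [l] := ubnP (size s); elim: l s k => // l IH [|x s] k /=; first by exists Emp.
rewrite ltnS => lt_l /andP[/andP[_ lt_kn] all_s] + Ex; rewrite Ex {x Ex} in lt_kn *.
move=> path_s.
have sorted_s := path_sorted path_s.
set m := block_size k s.
have lt_take : size (take m s) < l.
  by apply: leq_ltn_trans lt_l; rewrite size_take_min geq_minr.
have lt_drop : size (drop m s) < l.
  by apply: leq_ltn_trans lt_l; rewrite size_drop leq_subr.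
have [||a le_a Ea] := IH (take m s) k.+1 lt_take _ (take_sorted m sorted_s).
- apply/allP=> x x_u; have /andP[_ ->] := allP all_s _ (mem_take x_u).
  have : ~~ has (leq^~ k) (take m s) by rewrite has_take_leq ?find_size // ltnn.
  by move=> /hasPn/(_ _ x_u); rewrite andbT ltnNge.
- rewrite /m /block_size; case: (s) path_s => //= y s' /andP[].
  rewrite /step; case: (leqP y k) => //= lt_ky le_yk _.
  by apply/eqP; rewrite eqn_leq le_yk.
have [||v le_v Ev] := IH (drop m s) k lt_drop _ (drop_sorted m sorted_s).
- by apply/allP=> x x_v; apply: (allP all_s _ (mem_drop x_v)).
- rewrite -nth0 nth_drop addn0 /m /block_size; case: (boolP (has (leq^~ k) s)) => [has_s|].
    apply/eqP; rewrite eqn_leq (nth_find k has_s) /=.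
    have : nth k s (find (leq^~ k) s) \in s by rewrite mem_nth // -has_find.
    by move=> /(allP all_s) /andP[].
  by rewrite has_find -leqNgt => le_s; rewrite nth_default.
exists (Push a v); first by rewrite /= geq_max le_v andbT; lia.
by rewrite /= -Ea -Ev cat_take_drop.
Qed.

(** * Gap embeddings as embeddings of hereditary words *)

(** Strong gap-embeddability, read from left to right; [u] is the gap before the
    image of [x]. *)
Inductive gap_emb : seq nat -> seq nat -> Prop :=
| gap_emb_nil t : gap_emb [::] t
| gap_emb_cons x u s t :
    all (leq x) u -> gap_emb s t -> gap_emb (x :: s) (u ++ x :: t).

(** The strong gap condition for maps on natural numbers, which can be shifted
    without transporting bounds. *)
Definition gap_fun (s t : seq nat) (f : nat -> nat) : Prop :=
  [/\ forall i, i < size s -> f i < size t /\ nth 0 s i = nth 0 t (f i),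
      forall i, i.+1 < size s -> f i < f i.+1,
      forall i j, i.+1 < size s -> f i < j < f i.+1 ->
        nth 0 t (f i.+1) <= nth 0 t j
    & 0 < size s -> forall j, j < f 0 -> nth 0 t (f 0) <= nth 0 t j].

Lemma gap_emb_of_fun s t f : gap_fun s t f -> gap_emb s t.
Proof.
elim: s t f => [|x s IH] t f [emb_f mono_f gap_f init_f]; first exact: gap_emb_nil.
have [lt_f0 /= Ex] := emb_f 0 isT.
rewrite -(cat_take_drop (f 0) t) (drop_nth 0) // -Ex; apply: gap_emb_cons.
  apply/(all_nthP 0) => j; rewrite size_take lt_f0 => lt_j.
  by rewrite nth_take // Ex; apply: init_f.
have lt_f i : i < size s -> f 0 < f i.+1.
  elim: i => [|i IHi] lt_i; first exact: mono_f.
  by apply: ltn_trans (IHi (ltnW lt_i)) _; apply: mono_f.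
apply: (IH _ (fun i => f i.+1 - (f 0).+1)); split.
- move=> i lt_i; have [lt_fi E] := emb_f i.+1 lt_i; have := lt_f i lt_i.
  by rewrite size_drop nth_drop => lt_0i; rewrite subnKC //; split=> //; lia.
- move=> i lt_i; have := mono_f i.+1 lt_i; have := lt_f i (ltnW lt_i); lia.
- move=> i j lt_i lt_j; rewrite !nth_drop subnKC; last exact: lt_f.
  by apply: gap_f => //; have := lt_f i (ltnW lt_i); lia.
- move=> s0 j lt_j; rewrite !nth_drop subnKC; last exact: lt_f.
  by apply: gap_f => //; lia.
Qed.

Lemma gap_emb_fun s t : gap_emb s t -> exists f, gap_fun s t f.
Proof.
elim=> {s t} [t|x u s t le_xu _ [f [emb_f mono_f gap_f init_f]]]; first by exists id.
exists (fun i => if i is i'.+1 then (size u).+1 + f i' else size u).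
have nth_u : nth 0 (u ++ x :: t) (size u) = x by rewrite nth_cat ltnn subnn.
have nth_t j : nth 0 (u ++ x :: t) ((size u).+1 + j) = nth 0 t j.
  by rewrite nth_cat ltnNge (leq_trans (leqnSn _) (leq_addr _ _)) /= addSnnS addKn.
split.
- case=> [|i] /= lt_i; first by rewrite nth_u size_cat /=; split=> //; lia.
  have [lt_fi E] := emb_f i lt_i; rewrite nth_t E size_cat /=; split=> //; lia.
- by case=> [|i] /= lt_i; rewrite ?ltn_add2l ?mono_f //; lia.
- case=> [|i] j /= lt_i /andP[lt_j lt_ij].
    rewrite -(subnKC lt_j) !nth_t; apply: init_f => //; lia.
  have lt_uj : size u < j by lia.
  by rewrite -(subnKC lt_uj) !nth_t; apply: gap_f => //; lia.
- move=> _ j lt_j; rewrite nth_u nth_cat lt_j.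
  exact: (all_nthP 0 le_xu).
Qed.

Lemma gap_s_gap_emb s t : gap_s s t <-> gap_emb s t.
Proof.
split=> [[g [[mono_g emb_g gap_g] init_g]]|/gap_emb_fun [f [emb_f mono_f gap_f init_f]]].
  pose f i := if insub i is Some o then g o : nat else 0.
  have fE i (lt_i : i < size s) : f i = g (Ordinal lt_i) by rewrite /f insubT.
  apply: (@gap_emb_of_fun _ _ f); split.
  - by move=> i lt_i; rewrite fE -emb_g.
  - by move=> i lt_i; rewrite (fE _ (ltnW lt_i)) fE; apply: mono_g => /=.
  - move=> i j lt_i; rewrite (fE _ (ltnW lt_i)) fE => /andP[lt1 lt2].
    have lt_j := ltn_trans lt2 (ltn_ord _).
    by apply: (gap_g (Ordinal (ltnW lt_i)) _ _ (Ordinal lt_j)) => //=; apply/andP.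
  - move=> s0 j; rewrite fE => lt_j0; have lt_j := ltn_trans lt_j0 (ltn_ord _).
    exact: (init_g (Ordinal s0) _ (Ordinal lt_j)).
have lt_f (i : 'I_(size s)) : f i < size t by case: (emb_f i (ltn_ord i)).
have mono i j : i < j < size s -> f i < f j.
  elim: j => // j IHj /andP[]; rewrite ltnS leq_eqVlt => /orP[/eqP-> //|lt_ij] lt_j.
    exact: mono_f.
  by apply: ltn_trans (mono_f _ lt_j); apply: IHj; rewrite lt_ij ltnW.
exists (fun i => Ordinal (lt_f i)); split; first split.
- by move=> i i' lt_i /=; apply: mono; rewrite lt_i ltn_ord.
- by move=> i /=; case: (emb_f i (ltn_ord i)).
- move=> i i' E j /=; rewrite E => lt_j; apply: gap_f => //.
  by rewrite -E.
- move=> i E j /=; rewrite E; apply: init_f.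
  exact: leq_ltn_trans (leq0n _) (ltn_ord i).
Qed.

Lemma gap_emb_prefix x u s t :
  all (leq (head x s)) u -> gap_emb s t -> gap_emb s (u ++ t).
Proof.
move=> le_u st; case: st le_u => {s t} [t|y v s t le_v st] /= le_u.
  exact: gap_emb_nil.
by rewrite catA; apply: gap_emb_cons => //; rewrite all_cat le_u.
Qed.

Lemma gap_emb_cat x s t s' t' :
  all (leq (head x s')) t -> gap_emb s t -> gap_emb s' t' -> gap_emb (s ++ s') (t ++ t').
Proof.
move=> le_t st st'; elim: st le_t => {s t} [t|y u s t le_u _ IH] le_t.
  exact: gap_emb_prefix le_t st'.
rewrite -catA /=; apply: gap_emb_cons => //; apply: IH.
by move: le_t; rewrite all_cat /= => /and3P[].
Qed.

(** A letter that is skipped consists of entries at least [k], which may stand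
    in the gap before an entry [k]. *)
Lemma gap_emb_of_emb k v w : emb v w -> gap_emb (to_seq k v) (to_seq k w).
Proof.
move=> vw; elim: vw k => {v w} [w|v b w _ IH|a v b w _ IHa _ IHv] k.
- exact: gap_emb_nil.
- have -> : to_seq k (Push b w) = (k :: to_seq k.+1 b) ++ to_seq k w by [].
  apply: (gap_emb_prefix (x := k)) => //.
  have -> : head k (to_seq k v) = k by case: v {IH}.
  by rewrite /= leqnn; apply: sub_all (to_seq_ge k.+1 b) => x /ltnW.
- apply: (@gap_emb_cons _ [::]) => //; apply: (gap_emb_cat (x := k)) => //.
  have -> : head k (to_seq k v) = k by case: v {IHv}.
  by apply: sub_all (to_seq_ge k.+1 b) => x /ltnW.
Qed.

Lemma gap_emb_consE x s t :
  gap_emb (x :: s) t -> exists u t', [/\ t = u ++ x :: t', all (leq x) u & gap_emb s t'].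
Proof. by move=> H; inversion H; subst; exists u, t0. Qed.

(** Entries above [x] cannot be sent beyond the first entry [x] of [t'], which
    would then lie in a gap before a larger entry; and an entry [x] is not sent
    into [t]. *)
Lemma gap_emb_cut x s s' t t' :
  all (leq x.+1) s -> all (leq x.+1) t -> head x s' = x -> head x t' = x ->
  gap_emb (s ++ s') (t ++ t') -> gap_emb s t /\ gap_emb s' t'.
Proof.
move=> + + hs' ht'.
elim: s t => [|y s IH] t /= gt_s gt_t.
  case: s' hs' => [|y s'] /= => [_ _|->]; first by split; apply: gap_emb_nil.
  move=> /gap_emb_consE [u [v [E le_u sv]]]; split; first exact: gap_emb_nil.
  elim: t u gt_t E le_u => [|z t IHt] u /= => [_ -> le_u|]; first exact: gap_emb_cons.
  move=> /andP[gt_z gt_t]; case: u => [[Ez]|z' u [_ E] /andP[_ le_u]];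
    last exact: IHt E _.
  by move: gt_z; rewrite Ez ltnn.
case/andP: gt_s => gt_y gt_s /gap_emb_consE [u [v [E le_u sv]]].
have [t2 [Et Ev]] : exists t2, t = u ++ y :: t2 /\ v = t2 ++ t'.
  elim: t u {gt_t IH sv} E le_u => [|z t IHt] u /=.
    move=> E; move: ht'; rewrite E; case: u {E} => [|z u] /= => [Ey|Ez].
      by move: gt_y; rewrite Ey ltnn.
    by rewrite Ez leqNgt gt_y.
  case: u => [[-> <-]|z' u [-> E] /andP[_ le_u]]; first by exists t.
  by have [t2 [-> ->]] := IHt _ E le_u; exists t2.
move: gt_t; rewrite Et all_cat /= => /and3P[_ _ gt_t2].
have [|st2 s't'] := IH t2 gt_s gt_t2; first by rewrite -Ev.
by split=> //; apply: gap_emb_cons.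
Qed.

Lemma head_to_seq k w : head k (to_seq k w) = k.
Proof. by case: w. Qed.

Lemma emb_of_gap_emb k v w : gap_emb (to_seq k v) (to_seq k w) -> emb v w.
Proof.
elim: w k v => [|b IHb w IHw] k [|a v]; try by move=> _; apply: emb_Emp.
  by case/gap_emb_consE => -[|? ?] [? []].
case/gap_emb_consE => -[|z u] [t [/= E le_u st]].
  case: E => E; rewrite -E in st.
  have [sa sv] := gap_emb_cut (to_seq_ge _ _) (to_seq_ge _ _)
    (head_to_seq _ _) (head_to_seq _ _) st.
  by apply: emb_Push; [apply: IHb sa|apply: IHw sv].
case: E => _ E; apply: emb_skip; apply: (IHw k).
have : gap_emb ([::] ++ to_seq k (Push a v)) (to_seq k.+1 b ++ to_seq k w).
  by rewrite E; apply: gap_emb_cons => //; case/andP: le_u.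
by case/(@gap_emb_cut k); rewrite ?head_to_seq ?to_seq_ge.
Qed.

Lemma OT_to_term n k w : height w + k <= n -> OT n (to_term k w).
Proof.
elim: w k => [|a IHa w IHw] k; first by constructor.
rewrite /= addn_maxl geq_max => /andP[le_a le_w].
have ind_ge : forall k w, all (leq k) (indices (to_term k w)).
  move=> {}k {}w {IHa IHw le_a le_w}; elim: w k => //= b IHb w IHw k.
  rewrite leqnn all_cat IHw andbT; apply: sub_all (IHb k.+1) => x /ltnW //.
constructor; [apply: IHa; lia|apply: IHw; lia|lia| | |].
- by case: (a) => //=; lia.
- by case: (w) => //=; lia.
- move=> j le_jk; apply/negP => /(allP (ind_ge k.+1 a)); lia.
Qed.

(** The condition on symbols puts all indices of the first argument above [k],
    and the bound on [OT_S] then makes its first index, if any, equal to [k.+1]. *)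
Lemma to_term_onto n k a :
  OT n a -> all (leq k) (indices a) -> (OT_S a <= k%:Z)%R ->
  exists2 w, height w <= n - k & a = to_term k w.
Proof.
move=> Ha; elim: Ha k => {a} [|i a b _ IHa _ IHb lt_in Sa Sb K] k /=.
  by exists Emp.
rewrite all_cat => /andP[le_ki /andP[ge_a ge_b]] le_ik.
have Ei : i = k by lia.
subst i; have [||v le_v ->] := IHa k.+1.
- by apply/allP=> j j_a; rewrite ltnNge; apply/negP => /K; rewrite j_a.
- by rewrite -addn1 PoszD.
have [||w le_w ->] := IHb k => //.
by exists (Push v w) => //=; rewrite geq_max le_w andbT; lia.
Qed.

(** * The theorem *)

Lemma Sbar0_word n (s : Sbar0_type n) :
  exists w, level n w /\ proj1_sig s = to_seq 0 w.
Proof.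
case: s => s /=; rewrite /Sbar0 /Sbar => /andP[/andP[lt_s step_s] head_s].
have [|w le_w ->] := to_seq_onto (k := 0) lt_s step_s.
  by case: s head_s {lt_s step_s} => //= x s /eqP.
by exists w; rewrite /level -[n]subn0.
Qed.

Definition word_of n (s : Sbar0_type n) : hword :=
  proj1_sig (constructive_indefinite_description _ (Sbar0_word s)).

Lemma word_of_level n (s : Sbar0_type n) : level n (word_of s).
Proof. by case: (proj2_sig (constructive_indefinite_description _ (Sbar0_word s))). Qed.

Lemma word_ofK n (s : Sbar0_type n) : to_seq 0 (word_of s) = proj1_sig s.
Proof. by case: (proj2_sig (constructive_indefinite_description _ (Sbar0_word s))). Qed.

Definition seq_of n w (wn : level n w) : Sbar0_type n :=
  exist (fun s : seq nat => Sbar0 n s) _ (Sbar0_to_seq wn).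

Lemma seq_term_word n (s : Sbar0_type n) :
  seq_term (proj1_sig s) = to_term 0 (word_of s).
Proof. by rewrite -word_ofK seq_term_to_seq. Qed.

Lemma word_of_inj n : injective (@word_of n).
Proof. by move=> s t E; apply: val_inj; rewrite /= -!word_ofK E. Qed.

Lemma seq_ofK n w (wn : level n w) : word_of (seq_of wn) = w.
Proof.
by apply: (@to_term_inj 0); rewrite -seq_term_word /= seq_term_to_seq.
Qed.

(** The first entry is 0, below which no entry before its image can fall. *)
Lemma Sbar0_gap_wP n (s t : Sbar0_type n) : Sbar0_gap_w s t <-> Sbar0_gap_s s t.
Proof.
split=> [[g gP]|[g [gP _]]]; exists g => //; split=> // i E j _.
case: gP => _ <- _; rewrite E.
by case: s i g E => -[|x s] //= /andP[_ /eqP->].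
Qed.

Lemma Sbar0_gap_emb n (s t : Sbar0_type n) :
  Sbar0_gap_w s t <-> emb (word_of s) (word_of t).
Proof.
rewrite Sbar0_gap_wP /Sbar0_gap_s gap_s_gap_emb -!word_ofK.
by split; [apply: emb_of_gap_emb|apply: gap_emb_of_emb].
Qed.

Lemma Sbar0_precE n (s t : Sbar0_type n) :
  Sbar0_prec s t <-> (word_of s <= word_of t)%O.
Proof.
rewrite /Sbar0_prec /term_le !seq_term_word term_lt_to_term le_eqVlt.
split=> [[->|/(@to_term_inj 0) ->]|/orP[/eqP->|]]; rewrite ?orbT ?eqxx; by [|right|left].
Qed.

Lemma strict_precE n (s t : Sbar0_type n) :
  strict (@Sbar0_prec n) s t <-> (word_of s < word_of t)%O.
Proof.
rewrite /strict Sbar0_precE lt_neqAle; split=> [[-> neq]|/andP[neq ->]].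
  by rewrite andbT; apply/eqP => /word_of_inj.
by split=> // E; rewrite E eqxx in neq.
Qed.

Lemma prec_well_order n : well_order (@Sbar0_prec n).
Proof.
split; first split.
- by move=> s; apply/Sbar0_precE.
- by move=> s t u /Sbar0_precE st /Sbar0_precE tu; apply/Sbar0_precE/(le_trans st).
- move=> s t /Sbar0_precE st /Sbar0_precE ts; apply: word_of_inj.
  by apply/eqP; rewrite eq_le st.
- by move=> s t; case: (leP (word_of s) (word_of t)) => [?|/ltW ?];
    [left|right]; apply/Sbar0_precE.
- move=> s; move: {2}(word_of s) (erefl (word_of s)) => w.
  elim/(well_founded_ind hlt_wf): w s => w IH s E; constructor=> t /strict_precE lt_ts.
  by apply: IH erefl; rewrite -E.
Qed.

Lemma gap_wpo n : wpo (@Sbar0_gap_w n).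
Proof.
split; first split.
- by move=> s; apply/Sbar0_gap_emb/emb_refl.
- by move=> s t u /Sbar0_gap_emb st /Sbar0_gap_emb tu; apply/Sbar0_gap_emb/(emb_trans st).
- move=> s t /Sbar0_gap_emb/emb_le st /Sbar0_gap_emb/emb_le ts.
  by apply: word_of_inj; apply/eqP; rewrite eq_le st.
- move=> s; have [i [j [lt_ij e]]] := level_good (fun i => word_of_level (s i)).
  by exists i, j; split=> //; apply/Sbar0_gap_emb.
Qed.

Lemma prec_extends n : wo_extension (@Sbar0_gap_w n) (@Sbar0_prec n).
Proof.
split; first exact: prec_well_order.
by move=> s t /Sbar0_gap_emb/emb_le le_st; apply/Sbar0_precE.
Qed.

Lemma OT0_to_term n a : OT0 n a <-> exists2 w, level n w & a = to_term 0 w.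
Proof.
split=> [[Ha Sa]|[w wn ->]].
  have [||w le_w ->] := to_term_onto Ha (k := 0) => //.
    exact/allP.
  by exists w => //; rewrite /level -[n]subn0.
by split; [apply: OT_to_term; rewrite addn0|case: w {wn}].
Qed.

Theorem corollary7 (n : nat) (hn : 1 <= n) :
  (* seq_term identifies Sbar0 n with OT0 n *)
  [/\ forall s : Sbar0_type n, OT0 n (seq_term (proj1_sig s)),
      forall s t : Sbar0_type n, seq_term (proj1_sig s) = seq_term (proj1_sig t) -> s = t
    & forall a : term, OT0 n a -> exists s : Sbar0_type n, seq_term (proj1_sig s) = a] /\
  (* the weak and strong gap orders coincide on Sbar0 n *)
  (forall s t : Sbar0_type n, Sbar0_gap_w s t <-> Sbar0_gap_s s t) /\
  maximal_linear_extension (@Sbar0_gap_w n) (@Sbar0_prec n).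
Proof.
split; [split|split].
- move=> s; apply/OT0_to_term; exists (word_of s); first exact: word_of_level.
  exact: seq_term_word.
- by move=> s t; rewrite !seq_term_word => /to_term_inj/word_of_inj.
- move=> a /OT0_to_term [w wn ->]; exists (seq_of wn).
  by rewrite seq_term_word seq_ofK.
- exact: Sbar0_gap_wP.
- split; first exact: gap_wpo.
  exists (prec_extends n); split.
    exact: (ord_le_sup _ (exist _ _ (prec_extends n))).
  apply: ord_sup_le => -[R extR] /=; apply/order_type_leP.
  have [|h [hn' h_mono]] :=
    level_maximal (ext_wo extR) (@word_of_level n).
    by move=> s t /Sbar0_gap_emb/(ext_sub extR).
  exists (fun s => seq_of (hn' s)) => s t /h_mono lt_h.
  by apply/strict_precE; rewrite !seq_ofK.
Qed.
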